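(* Let $p,q,n$ be positive integers with $n\ge 2$, let $\mu\in\mathbb{R}^{pq}$, and let $\Gamma\in\mathcal{M}_{p,p}(\mathbb{R})$ and $\Psi\in\mathcal{M}_{q,q}(\mathbb{R})$ be diagonal matrices with strictly positive diagonal entries ($\mu,\Gamma,\Psi$ unknown). Let $X_1,\ldots,X_n$ be independent random matrices in $\mathcal{M}_{p,q}(\mathbb{R})$ with $\mathrm{vec}(X_k)\sim\mathcal{N}(\mu,\Psi\otimes\Gamma)$ for $k=1,\ldots,n$. Then the maximum likelihood estimator of $\Psi\otimes\Gamma$ (in the model in which both $\Gamma$ and $\Psi$ are constrained to be diagonal) exists with probability $1$.
   Context: $\mathcal{M}_{p,q}(\mathbb{R})$ is the set of real $p\times q$ matrices, $\mathrm{vec}$ stacks the columns of a matrix into one vector, and $\otimes$ is the Kronecker product. The likelihood function, for $M\in\mathcal{M}_{p,q}(\mathbb{R})$ (with $\mathrm{vec}(M)$ the mean vector) and positive definite $\Gamma\in\mathcal{M}_{p,p}(\mathbb{R})$, $\Psi\in\mathcal{M}_{q,q}(\mathbb{R})$, is $$L(M,\Gamma,\Psi)=(2\pi)^{-\frac12 pqn}|\Gamma|^{-\frac12 qn}|\Psi|^{-\frac12 pn}\exp\Big(-\tfrac12\,\mathrm{trace}\Big(\Psi^{-1}\sum_{k=1}^n (X_k-M)^T\Gamma^{-1}(X_k-M)\Big)\Big),$$ where $|A|$ is the determinant of $A$. It depends on $(\Gamma,\Psi)$ only through $\Psi\otimes\Gamma$. In the diagonal model, a maximum likelihood estimator of $\Psi\otimes\Gamma$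 is a matrix $\hat\Psi\otimes\hat\Gamma$, with $\hat\Gamma,\hat\Psi$ diagonal with strictly positive diagonal entries, such that $L$ attains its maximum over all $M\in\mathcal{M}_{p,q}(\mathbb{R})$ and all diagonal $\Gamma,\Psi$ with strictly positive diagonal entries at $(\hat M,\hat\Gamma,\hat\Psi)$, where $\hat M=\frac1n\sum_{k=1}^n X_k$. The estimator exists if at least one such matrix exists. *)

(* Defs.v *)
(* MathComp / MathComp-Analysis *)
From HB Require Import structures.
From mathcomp Require Import all_boot all_order all_algebra.
From mathcomp Require Import all_classical all_reals all_analysis.
From mathcomp.real_closed Require Export mxtens.

Set Implicit Arguments.
Unset Strict Implicit.
Unset Printing Implicit Defensive.

Import Order.TTheory GRing.Theory Num.Theory.
Import numFieldNormedType.Exports.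
Local Open Scope classical_set_scope.
Local Open Scope ring_scope.

Section Vec.
Context {R : realType}.

(* Column stacking: the entry (i, j) sits at position j * p + i, which is
   mxtens_index (j, i), so that the covariance matrix matching the Kronecker
   product Psi *t Gamma has size q * p. *)
Definition vec p q (A : 'M[R]_(p, q)) : 'cV[R]_(q * p) :=
  \col_k A (mxtens_unindex k).2 (mxtens_unindex k).1.

Lemma vecE p q (A : 'M[R]_(p, q)) i j :
  vec A (mxtens_index (j, i)) 0 = A i j.
Proof. by rewrite mxE mxtens_indexK. Qed.

Lemma vec_mul p q (A : 'M[R]_p) (M : 'M[R]_(p, q)) (B : 'M[R]_q) :
  vec (A *m M *m B^T) = (B *t A) *m vec M.
Proof.
apply/colP => k; case: (mxtens_indexP k) => j i; rewrite vecE !mxE.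
transitivity (\sum_a \sum_b B j a * A i b * M b a).
  by apply: eq_bigr => a _; rewrite !mxE mulr_suml; apply: eq_bigr => b _;
    rewrite mulrC mulrA.
rewrite pair_big (reindex (@mxtens_unindex q p)); last first.
  by exists (@mxtens_index q p) => x _; rewrite (mxtens_indexK, mxtens_unindexK).
by apply: eq_bigr => l _; case: (mxtens_indexP l) => a b;
  rewrite tensmxE vecE mxtens_indexK.
Qed.

End Vec.

Section RandomMatrices.
Context {R : realType} d {T : measurableType d} (P : probability T R).

Definition borel_mx p q : set (set 'M[R]_(p, q)) :=
  <<s [set U : set 'M[R]_(p, q) | open U] >>.

Definition random_matrix p q (X : T -> 'M[R]_(p, q)) : Prop :=
  forall B, @borel_mx p q B -> measurable (X @^-1` B).

Definition independent_matrices n p q (X : 'I_n -> T -> 'M[R]_(p, q)) : Prop :=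
  forall (J : {set 'I_n}) (B : 'I_n -> set 'M[R]_(p, q)),
    (forall k, @borel_mx p q (B k)) ->
    P (\bigcap_(k in [set` J]) (X k @^-1` B k)) =
    (\prod_(k in J) P (X k @^-1` B k))%E.

(* The normal law with mean m and variance v. normal_prob takes the standard
   deviation, and is not the point mass when the latter is 0. *)
Definition normal_law (m v : R) (A : set R) : \bar R :=
  if v == 0 then \d_m A else normal_prob m (Num.sqrt v) A.

(* Y ~ N(mu, Sigma): every linear combination u^T Y is normal with mean u^T mu
   and variance u^T Sigma u. *)
Definition multinormal N (Y : T -> 'cV[R]_N) (mu : 'cV[R]_N)
    (Sigma : 'M[R]_N) : Prop :=
  forall (u : 'cV[R]_N) (A : set R), measurable A ->
    P ((fun w => (u^T *m Y w) 0 0) @^-1` A) =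
    normal_law ((u^T *m mu) 0 0) ((u^T *m Sigma *m u) 0 0) A.

End RandomMatrices.

Section Likelihood.
Context {R : realType}.

Definition pos_diag m (A : 'M[R]_m) : Prop :=
  is_diag_mx A /\ forall i, 0 < A i i.

Definition likelihood n p q (x : 'I_n -> 'M[R]_(p, q))
    (M : 'M[R]_(p, q)) (Gamma : 'M[R]_p) (Psi : 'M[R]_q) : R :=
  (2 * pi) `^ (- (p * q * n)%:R / 2)
  * \det Gamma `^ (- (q * n)%:R / 2)
  * \det Psi `^ (- (p * n)%:R / 2)
  * expR (- \tr (invmx Psi *m
                 \sum_(k < n) ((x k - M)^T *m invmx Gamma *m (x k - M))) / 2).

Definition sample_mean n p q (x : 'I_n -> 'M[R]_(p, q)) : 'M[R]_(p, q) :=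
  n%:R^-1 *: \sum_(k < n) x k.

Definition diag_mle n p q (x : 'I_n -> 'M[R]_(p, q)) (S : 'M[R]_(q * p)) : Prop :=
  exists (Gammah : 'M[R]_p) (Psih : 'M[R]_q),
    [/\ pos_diag Gammah, pos_diag Psih, S = Psih *t Gammah &
      forall (M : 'M[R]_(p, q)) (Gamma : 'M[R]_p) (Psi : 'M[R]_q),
        pos_diag Gamma -> pos_diag Psi ->
        likelihood x M Gamma Psi <= likelihood x (sample_mean x) Gammah Psih].

End Likelihood.

(* Main.v *)
(** Write Gamma = diag(exp(-a_i)) and Psi = diag(exp(-b_j)). Up to an additive
    constant, twice the log-likelihood is the sum over i, j of
    n t_ij - S_ij exp(t_ij), where t_ij = a_i + b_j and S_ij is the sum over k of
    (X_k - M)_ij^2, which is smallest at the sample mean. If every S_ij is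
    positive, each summand tends to -oo as |t_ij| grows. The t_ij determine (a, b)
    once b_0 = 0, which costs nothing since shifting a constant from b to a keeps
    every t_ij; so the maximum may be sought in a compact box. Finally S_ij > 0
    as soon as the (i, j) entries of two observations differ, which holds almost
    surely: independent real variables, one of which gives any interval of length
    e a probability at most C e, coincide with probability at most C e (cut the
    line into such intervals). *)

Require Import Defs.
From HB Require Import structures.
From mathcomp Require Import all_boot all_order all_algebra.
From mathcomp Require Import all_classical all_reals all_analysis.
From mathcomp Require Import measurable_realfun ring lra.
Import Order.TTheory GRing.Theory Num.Theory.
Import numFieldNormedType.Exports.
Local Open Scope classical_set_scope.
Local Open Scope ring_scope.

(** * Coercivity and maximum of the profile function *)

(** For [t < 0] the exponential term is dropped. For [t >= 0], with L = ln(2c/s), one has s exp(t) =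
    2c exp(t - L) >= 2c (1 + t - L): this tangent has slope 2c, twice that of the linear term, so a
    slope -c remains. *)
Lemma affine_sub_exp_le {R : realType} (c s t : R) : 0 < c -> 0 < s ->
  c * t - s * expR t <= 2 * c * `|ln (2 * c / s)| - c * `|t|.
Proof.
move=> c0 s0.
have L0 : 0 <= `|ln (2 * c / s)| by [].
have [t0|t0] := ltP t 0.
  rewrite (ltr0_norm t0).
  have := mulr_ge0 (ltW s0) (expR_ge0 t); have := mulr_ge0 (ltW c0) L0.
  by move=> *; lra.
rewrite (ger0_norm t0).
have cs0 : 0 < 2 * c / s by rewrite divr_gt0// mulr_gt0.
have -> : s * expR t = 2 * c * expR (t - ln (2 * c / s)).
  rewrite expRB lnK ?posrE//; field; rewrite !gt_eqF//.
have := expR_ge1Dx (t - ln (2 * c / s)); set e := expR _ => he.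
have : 2 * c * (1 + (t - ln (2 * c / s))) <= 2 * c * e.
  by rewrite ler_pM2l// mulr_gt0.
have : c * ln (2 * c / s) <= c * `|ln (2 * c / s)|.
  by rewrite ler_pM2l// ler_norm.
by move=> *; lra.
Qed.

(* Twice the log-likelihood in the coordinates a, b, without its constant term. *)
Definition profile {R : realType} {p q : nat} (c : R) (s : 'I_p -> 'I_q -> R)
    (a : 'I_p -> R) (b : 'I_q -> R) : R :=
  \sum_i \sum_j (c * (a i + b j) - s i j * expR (a i + b j)).

Lemma profile_attains_max {R : realType} {p q : nat} (c : R)
    (s : 'I_p -> 'I_q -> R) :
  (0 < p)%N -> (0 < q)%N -> 0 < c -> (forall i j, 0 < s i j) ->
  exists a b, forall a' b', profile c s a' b' <= profile c s a b.
Proof.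
move=> p0 q0 c0 s0.
pose i0 := Ordinal p0; pose j0 := Ordinal q0.
pose C := \sum_i \sum_j (2 * c * `|ln (2 * c / s i j)|).
have profile_le a b : profile c s a b <= C - \sum_i \sum_j c * `|a i + b j|.
  rewrite /profile /C -sumrB ler_sum// => i _; rewrite -sumrB ler_sum// => j _.
  exact: affine_sub_exp_le.
pose F0 := profile c s (fun=> 0) (fun=> 0).
(* Wherever the profile is at least its value [F0] at the origin, [profile_le] gives c |a_i + b_j|
   <= C - F0 for each single pair, the other terms being nonnegative. *)
pose K := (C - F0) / c.
have K0 : 0 <= K.
  rewrite divr_ge0 ?(ltW c0)// subr_ge0; apply: le_trans (profile_le _ _) _.
  by rewrite gerBl; apply: sumr_ge0 => i _; apply: sumr_ge0 => j _;
    rewrite mulr_ge0// ltW.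
have K_ge a b i j : F0 <= profile c s a b -> `|a i + b j| <= K.
  move=> F0le; rewrite ler_pdivlMr// mulrC lerBrDr -lerBrDl.
  apply: le_trans F0le _; apply: le_trans (profile_le _ _) _.
  rewrite lerB// (bigD1 i)//= (bigD1 j)//= -addrA lerDl addr_ge0//.
    by apply: sumr_ge0 => ? _; rewrite mulr_ge0// ltW.
  by apply: sumr_ge0 => ? _; apply: sumr_ge0 => ? _; rewrite mulr_ge0// ltW.
(* The pair (a, b) is encoded as one row vector. After normalising b_0 = 0, the new a_i is some
   t_ij, at most [K] in absolute value, and the new b_j is a difference of two of them, whence the
   radius 2K. *)
pose box := [set v : 'rV[R]_(p + q) | forall i, `[- (2 * K), 2 * K]%classic (v ord0 i)].
have box_compact : compact box.
  apply: (@rV_compact _ _ (fun=> `[- (2 * K), 2 * K]%classic)) => _.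
  exact: segment_compact.
pose f (v : 'rV[R]_(p + q)) :=
  profile c s (fun i => v ord0 (lshift q i)) (fun j => v ord0 (rshift p j)).
have f_continuous : continuous f.
  move=> v; have Fv : Filter (nbhs v) := nbhs_filter v.
  apply: (@cvg_big R _ _ _ _ add_continuous _ (nbhs v) _ _ _ Fv) => i _.
  apply: (@cvg_big R _ _ _ _ add_continuous _ (nbhs v) _ _ _ Fv) => j _.
  have cvgD2 : (fun v : 'rV[R]_(p + q) => v ord0 (lshift q i) + v ord0 (rshift p j)) @ v
      --> v ord0 (lshift q i) + v ord0 (rshift p j).
    by apply: cvgD; exact: coord_continuous.
  apply: cvgB; first by apply: cvgM => //; exact: cvg_cst.
  apply: cvgM; first exact: cvg_cst.
  apply: (cvg_comp _ _ cvgD2); exact: continuous_expR.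
have box0 : box 0 by move=> i; rewrite mxE/= in_itv/= oppr_le0 mulr_ge0.
have [v _ fv] : exists2 v, v \in box & forall w, w \in box -> f w <= f v.
  apply: EVT_max_rV => //; first by exists 0.
  by apply: continuous_subspaceT.
exists (fun i => v ord0 (lshift q i)), (fun j => v ord0 (rshift p j)) => a b.
(* Pairs with value below [F0] are beaten by the origin, which lies in the box; the others are
   shifted into the box without changing their value. *)
have [F0le|F0lt] := leP F0 (profile c s a b); last first.
  apply: le_trans (ltW F0lt) _; have := fv 0; rewrite inE => /(_ box0).
  congr (_ <= _); rewrite /F0 /f /profile.
  by apply: eq_bigr => i _; apply: eq_bigr => j _; rewrite !mxE.
pose w : 'rV[R]_(p + q) :=
  row_mx (\row_i (a i + b j0)) (\row_j (b j - b j0)).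
have -> : profile c s a b = f w.
  rewrite /f /profile; apply: eq_bigr => i _; apply: eq_bigr => j _.
  by rewrite row_mxEl row_mxEr !mxE; congr (c * _ - _ * expR _); ring.
apply: fv; rewrite inE => l /=; rewrite in_itv/= -ler_norml.
case: (split_ordP l) => k ->; rewrite (row_mxEl, row_mxEr) mxE.
  by have := K_ge a b k j0 F0le; move=> *; lra.
have -> : b k - b j0 = (a i0 + b k) - (a i0 + b j0) by ring.
apply: le_trans (ler_normB _ _) _.
by have := K_ge a b i0 k F0le; have := K_ge a b i0 j0 F0le; move=> *; lra.
Qed.

(** * Sums of squared deviations *)

(** The deviations from the mean sum to zero, so expanding about the mean leaves no cross term. *)
Lemma sum_sqr_mean_le {R : realType} {n : nat} (y : 'I_n -> R) (m : R) :
  \sum_k (y k - n%:R^-1 * \sum_l y l) ^+ 2 <= \sum_k (y k - m) ^+ 2.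
Proof.
case: n y => [|n] y; first by rewrite !big_ord0.
set e := _^-1 * _.
have dev0 : \sum_k (y k - e) = 0.
  rewrite sumrB sumr_const card_ord -[e *+ _]mulr_natl /e mulrA mulfV.
    by rewrite mul1r subrr.
  by rewrite pnatr_eq0.
have -> : \sum_k (y k - m) ^+ 2 =
    \sum_k (y k - e) ^+ 2 + \sum_(k < n.+1) (e - m) ^+ 2.
  transitivity (\sum_k ((y k - e) ^+ 2 + (e - m) ^+ 2 + 2 * (e - m) * (y k - e))).
    by apply: eq_bigr => k _; ring.
  by rewrite !big_split/= -[X in _ + X = _]mulr_sumr dev0 mulr0 addr0.
by rewrite lerDl; apply: sumr_ge0 => k _; rewrite sqr_ge0.
Qed.

Lemma sum_sqr_dev_gt0 {R : realType} {n : nat} (y : 'I_n -> R) (k l : 'I_n) (m : R) :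
  y k != y l -> 0 < \sum_i (y i - m) ^+ 2.
Proof.
move=> ykl; rewrite lt_def sumr_ge0 ?andbT; last by move=> *; rewrite sqr_ge0.
apply: contra ykl; rewrite psumr_eq0; last by move=> *; rewrite sqr_ge0.
move=> /allP y0.
have yE i : y i = m.
  by have := y0 i (mem_index_enum i); rewrite sqrf_eq0 subr_eq0 => /eqP.
by rewrite !yE.
Qed.

(** * The likelihood in exponential coordinates *)

Definition expdiag {R : realType} {m : nat} (a : 'I_m -> R) : 'M[R]_m :=
  diag_mx (\row_i expR (- a i)).

Lemma expdiag_pos {R : realType} {m : nat} (a : 'I_m -> R) : pos_diag (expdiag a).
Proof.
split; first exact: diag_mx_is_diag.
by move=> i; rewrite !mxE eqxx mulr1n expR_gt0.
Qed.

Lemma pos_diag_exp {R : realType} {m : nat} (A : 'M[R]_m) :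
  pos_diag A -> exists a, A = expdiag a.
Proof.
move=> [/diag_mxP[d ->] d0]; exists (fun i => - ln (d 0 i)).
congr diag_mx; apply/rowP => i; rewrite mxE opprK lnK// posrE.
by have := d0 i; rewrite mxE eqxx.
Qed.

Lemma det_expdiag {R : realType} {m : nat} (a : 'I_m -> R) :
  \det (expdiag a) = expR (- \sum_i a i).
Proof.
by rewrite det_diag -sumrN expR_sum; apply: eq_bigr => i _; rewrite mxE.
Qed.

Lemma invmx_expdiag {R : realType} {m : nat} (a : 'I_m -> R) :
  invmx (expdiag a) = diag_mx (\row_i expR (a i)).
Proof.
have unitD : expdiag a \in unitmx.
  by rewrite unitmxE det_expdiag unitfE gt_eqF ?expR_gt0.
apply: (can_inj (mulKmx unitD)); rewrite mulmxV//.
apply/matrixP => i j; rewrite mul_diag_mx !mxE.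
by case: eqP => // [->|_]; rewrite ?mulr1n ?mulr0n ?mulr0// -expRD addNr expR0.
Qed.

Lemma mxtrace_quadratic_diag {R : comPzRingType} {p q : nat} (d : 'rV[R]_p)
    (e : 'rV[R]_q) (Y : 'M[R]_(p, q)) :
  \tr (diag_mx e *m (Y^T *m diag_mx d *m Y)) =
  \sum_i \sum_j d 0 i * e 0 j * Y i j ^+ 2.
Proof.
rewrite exchange_big; apply: eq_bigr => j _; rewrite mul_diag_mx !mxE mulr_sumr.
by apply: eq_bigr => i _; rewrite mul_mx_diag !mxE; ring.
Qed.

Definition square_dev {R : realType} {n p q : nat} (x : 'I_n -> 'M[R]_(p, q))
    (M : 'M[R]_(p, q)) (i : 'I_p) (j : 'I_q) : R :=
  \sum_k (x k i j - M i j) ^+ 2.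

(** The powers of the determinants give the linear part of the profile, the trace its exponential
    part. *)
Lemma likelihood_expdiag {R : realType} {n p q : nat} (x : 'I_n -> 'M[R]_(p, q))
    (M : 'M[R]_(p, q)) (a : 'I_p -> R) (b : 'I_q -> R) :
  likelihood x M (expdiag a) (expdiag b) =
  (2 * pi) `^ (- (p * q * n)%:R / 2) * expR (profile n%:R (square_dev x M) a b / 2).
Proof.
rewrite /likelihood !det_expdiag -!expRM -!mulrA -!expRD; congr (_ * expR _).
have -> : \tr (invmx (expdiag b) *m
    \sum_k ((x k - M)^T *m invmx (expdiag a) *m (x k - M))) =
    \sum_i \sum_j square_dev x M i j * expR (a i + b j).
  rewrite !invmx_expdiag mulmx_sumr raddf_sum/=.
  under eq_bigr do rewrite mxtrace_quadratic_diag.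
  rewrite exchange_big; apply: eq_bigr => i _; rewrite exchange_big.
  apply: eq_bigr => j _; rewrite /square_dev mulr_suml; apply: eq_bigr => k _.
  by rewrite !mxE expRD; ring.
have -> : profile n%:R (square_dev x M) a b =
    n%:R * q%:R * \sum_i a i + n%:R * p%:R * \sum_j b j -
    \sum_i \sum_j square_dev x M i j * expR (a i + b j).
  rewrite /profile; under eq_bigr do rewrite sumrB.
  rewrite sumrB; congr (_ - _).
  under eq_bigr do
    rewrite -mulr_sumr big_split/= sumr_const card_ord -[a _ *+ _]mulr_natl mulrDr mulrA.
  rewrite big_split/= -mulr_sumr sumr_const card_ord -[X in _ + X = _]mulr_natl.
  by ring.
by rewrite !natrM; field.
Qed.

Lemma diag_mle_exists {R : realType} {n p q : nat} (x : 'I_n -> 'M[R]_(p, q))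
    (k l : 'I_n) : (0 < p)%N -> (0 < q)%N ->
  (forall i j, x k i j != x l i j) -> exists S, diag_mle x S.
Proof.
move=> p0 q0 xkl.
have n0 : 0 < n%:R :> R by rewrite ltr0n (leq_ltn_trans _ (ltn_ord k)).
have dev_gt0 i j : 0 < square_dev x (sample_mean x) i j.
  exact: (sum_sqr_dev_gt0 (fun k => x k i j) k l _ (xkl i j)).
have [a [b maxab]] := profile_attains_max _ _ p0 q0 n0 dev_gt0.
exists (expdiag b *t expdiag a), (expdiag a), (expdiag b).
split; [exact: expdiag_pos|exact: expdiag_pos|by []|].
move=> M G Psi /pos_diag_exp[a' ->] /pos_diag_exp[b' ->].
rewrite !likelihood_expdiag ler_wpM2l ?powR_ge0// ler_expR ler_pM2r ?invr_gt0//.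
(* It remains to pass from [M] to the sample mean with a', b' fixed: this lowers every [square_dev],
   each of which enters the profile with a negative weight. *)
apply: le_trans (maxab a' b'); rewrite /profile.
apply: ler_sum => i _; apply: ler_sum => j _; rewrite lerB// ler_pM2r ?expR_gt0//.
rewrite /square_dev.
have -> : sample_mean x i j = n%:R^-1 * \sum_l x l i j.
  by rewrite !mxE summxE.
exact: sum_sqr_mean_le.
Qed.

(** * Almost sure distinctness of independent variables *)

Lemma ae_neq_of_independent {d : measure_display} {T : measurableType d}
    {R : realType} (P : probability T R) (Y Z : T -> R) (C : R) :
  measurable_fun setT Y -> measurable_fun setT Z ->
  (forall A, measurable A ->
    P (Y @^-1` A `&` Z @^-1` A) = (P (Y @^-1` A) * P (Z @^-1` A))%E) ->
  (forall a b, a < b -> (P (Y @^-1` `[a, b[) <= (C * (b - a))%:E)%E) ->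
  {ae P, forall w, Y w != Z w}.
Proof.
move=> mY mZ indep small.
have mpre (f : T -> R) A : measurable_fun setT f -> measurable A ->
    measurable (f @^-1` A).
  by move=> mf mA; rewrite -[X in measurable X]setTI; exact: mf.
have C0 : 0 <= C.
  have /= := small 0 1 ltr01; rewrite subr0 mulr1 -lee_fin.
  exact: le_trans (measure_ge0 _ _).
pose E := [set w | Y w = Z w].
have mE : measurable E.
  have -> : E = (fun w => Y w - Z w) @^-1` [set 0].
    apply/seteqP; split => w /=; rewrite /E/= => /eqP; last by rewrite subr_eq0 => /eqP.
    by rewrite -subr_eq0 => /eqP.
  by apply: mpre => //; exact: measurable_funB.
have PE_le e : 0 < e -> (P E <= (C * e)%:E)%E.
  move=> e0.
  pose I (z : int) : set R := `[z%:~R * e, (z + 1)%:~R * e[%classic.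
  have I_inj x z : I z x -> z = Num.floor (x / e).
    rewrite /I/= in_itv/= -ler_pdivlMr// -ltr_pdivrMr// => xz.
    by apply/esym/eqP; rewrite floor_eq.
  (* The cells are reindexed by naturals through the countable encoding of [int]; naturals that
     encode no integer get the empty cell. *)
  pose F k := if @pickle_inv int k is Some z then I z else set0.
  have mF k : measurable (F k).
    by rewrite /F; case: pickle_inv => [z|]; [exact: measurable_itv|exact: measurable0].
  have F_small k : (P (Y @^-1` F k) <= (C * e)%:E)%E.
    rewrite /F; case: pickle_inv => [z|]; last first.
      by rewrite preimage_set0 measure0 lee_fin mulr_ge0// ltW.
    apply: le_trans (small _ _ _) _; first by rewrite ltr_pM2r// ltr_int ltrDl.
    by rewrite intrD mulrDl mul1r addrAC subrr add0r.
  have F_triv : trivIset setT F.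
    move=> k l _ _ [x [/=]]; rewrite /F.
    case Ek: pickle_inv => [z|]//; case El: pickle_inv => [z'|]// /I_inj zx /I_inj z'x.
    have := @pickle_invK int k; have := @pickle_invK int l.
    by rewrite /oapp Ek El zx z'x => -> ->.
  (* Equal values fall into the same cell. *)
  apply: (@le_trans _ _ (\sum_(0 <= k <oo) P (Y @^-1` F k `&` Z @^-1` F k))%E).
    apply: measure_sigma_subadditive => //.
      by move=> k; apply: measurableI; exact: mpre.
    move=> w YZ; have [z Iz] : exists z, I z (Y w).
      exists (Num.floor (Y w / e)); rewrite /I/= in_itv/=.
      by rewrite -ler_pdivlMr// -ltr_pdivrMr// floor_itv.
    have Fz : F (pickle z) = I z by rewrite /F pickleK_inv.
    exists (pickle z); first by [].
    by rewrite Fz; split; rewrite /preimage/mkset/= -?YZ.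
  (* Independence splits each term, and [Y] contributes at most C e; the events for [Z] are
     disjoint, so their probabilities sum to at most 1. *)
  apply: (@le_trans _ _ (\sum_(0 <= k <oo) ((C * e)%:E * P (Z @^-1` F k)))%E).
    apply: lee_nneseries => k; first by rewrite measure_ge0.
    by rewrite indep// lee_wpmul2r.
  rewrite nneseriesZl// -measure_semi_bigcup.
  - by rewrite -[leRHS]mule1 lee_wpmul2l ?lee_fin ?mulr_ge0 ?(ltW e0)//
      probability_le1//; apply: bigcup_measurable => k _; exact: mpre.
  - by move=> k; exact: mpre.
  - by move=> k l kT lT [w [Zk Zl]]; apply: F_triv => //; exists (Z w).
  - by apply: bigcup_measurable => k _; exact: mpre.
exists E; split => //; last by move=> w /= /negP/negPn/eqP.
apply/eqP; rewrite eq_le measure_ge0 andbT; apply/lee_addgt0Pr => e e0.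
rewrite add0e; have C1 : 0 < C + 1 by rewrite ltr_wpDl.
(* Dividing by C + 1 rather than C covers the case C = 0. *)
apply: le_trans (PE_le (e / (C + 1)) _) _; first by rewrite divr_gt0.
rewrite lee_fin mulrA ler_pdivrMr// mulrC; rewrite ler_pM2l//; lra.
Qed.

(** * Laws, measurability and independence of the matrix entries *)

(** The normal density is bounded by its peak value. *)
Lemma normal_prob_itv_le {R : realType} (m s a b : R) : s != 0 -> a < b ->
  (normal_prob m s `[a, b[%classic <= (normal_peak s * (b - a))%:E)%E.
Proof.
move=> s0 ab; rewrite /normal_prob.
have -> : ((normal_peak s * (b - a))%:E =
    \int[@lebesgue_measure R]_(x in `[a, b[%classic) cst (normal_peak s)%:E x)%E.
  by rewrite integral_cst//= lebesgue_measure_itv/= lte_fin ab.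
apply: ge0_le_integral => //.
- by move=> x _; rewrite lee_fin normal_pdf_ge0.
- apply/measurable_EFinP; apply: measurable_funTS; exact: measurable_normal_pdf.
- by move=> x _; rewrite lee_fin normal_pdf_ub.
Qed.

(** Open rays generate the Borel sets of the reals, and their preimages are open because a
    coordinate is continuous. *)
Lemma measurable_entry {R : realType} {p q : nat} (i : 'I_p) (j : 'I_q) :
  measurable_fun setT
    (fun M : g_sigma_algebraType [set U : set 'M[R]_(p, q) | open U] => M i j).
Proof.
apply: (measurability _ (RGenOInfty.measurableE R)) => _ [_ [a ->] <-].
rewrite setTI; apply: sub_sigma_algebra => /=.
apply: (@open_comp _ _ (fun M : 'M[R]_(p, q) => M i j)); last exact: interval_open.
by move=> M _; exact: coord_continuous.
Qed.

Lemma measurable_random_entry {d : measure_display} {T : measurableType d}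
    {R : realType} {p q : nat} (X : T -> 'M[R]_(p, q)) (i : 'I_p) (j : 'I_q) :
  random_matrix X -> measurable_fun setT (fun w => X w i j).
Proof.
move=> rX _ A mA; rewrite setTI.
apply: (rX [set M | A (M i j)]).
by have := measurable_entry i j measurableT A mA; rewrite setTI.
Qed.

Lemma independent_entries {d : measure_display} {T : measurableType d}
    {R : realType} (P : probability T R) {n p q : nat}
    (X : 'I_n -> T -> 'M[R]_(p, q)) (k l : 'I_n) (i : 'I_p) (j : 'I_q) (A B : set R) :
  independent_matrices P X -> k != l -> measurable A -> measurable B ->
  P ((fun w => X k w i j) @^-1` A `&` (fun w => X l w i j) @^-1` B) =
  (P ((fun w => X k w i j) @^-1` A) * P ((fun w => X l w i j) @^-1` B))%E.
Proof.
move=> indep kl mA mB.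
(* [independent_matrices] takes a set for every index; only those at [k] and [l] matter, since it is
   applied to the pair {k, l}. *)
pose D m : set 'M[R]_(p, q) := [set M | (if m == k then A else B) (M i j)].
have mD m : borel_mx (D m).
  have mAB : measurable (if m == k then A else B) by case: ifP.
  by have := measurable_entry i j measurableT _ mAB; rewrite setTI.
have lk : (l == k) = false by rewrite eq_sym (negbTE kl).
have := indep [set k; l]%SET D mD.
rewrite big_setU1 ?inE// big_set1.
have -> : X k @^-1` D k = (fun w => X k w i j) @^-1` A by rewrite /D eqxx.
have -> : X l @^-1` D l = (fun w => X l w i j) @^-1` B by rewrite /D lk.
move=> <-; congr (P _); apply/seteqP; split => w /=.
  move=> [Aw Bw] m /=; rewrite !inE => /orP[|] /eqP ->.
    by rewrite /D/= eqxx.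
  by rewrite /D/= lk.
move=> Dw; split.
  by have := Dw k; rewrite /= !inE eqxx /D/= eqxx; exact.
by have := Dw l; rewrite /= !inE eqxx orbT /D/= lk; exact.
Qed.

Lemma multinormal_entry {d : measure_display} {T : measurableType d}
    {R : realType} (P : probability T R) {p q : nat} (Y : T -> 'M[R]_(p, q))
    (mu : 'cV[R]_(q * p)) (Sigma : 'M[R]_(q * p)) (i : 'I_p) (j : 'I_q) (A : set R) :
  multinormal P (fun w => vec (Y w)) mu Sigma -> measurable A ->
  P ((fun w => Y w i j) @^-1` A) =
  normal_law (mu (mxtens_index (j, i)) 0)
    (Sigma (mxtens_index (j, i)) (mxtens_index (j, i))) A.
Proof.
set k := mxtens_index _ => normalY mA.
(* The linear combination given by a basis vector is a single entry; its variance is the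
   corresponding diagonal entry of [Sigma]. *)
have := normalY (delta_mx k 0) A mA.
rewrite trmx_delta -!rowE -colE !mxE.
move=> <-.
have -> // : (fun w => Y w i j) =
    (fun w => ((delta_mx 0 k : 'rV_(q * p)) *m vec (Y w)) 0 0).
by apply/funext => w; rewrite -rowE mxE vecE.
Qed.

Theorem theorem4 (R : realType) (d : measure_display) (T : measurableType d)
    (P : probability T R) (p q n : nat)
    (mu : 'cV[R]_(q * p)) (Gamma : 'M[R]_p) (Psi : 'M[R]_q)
    (X : 'I_n -> T -> 'M[R]_(p, q)) :
  (0 < p)%N -> (0 < q)%N -> (2 <= n)%N ->
  pos_diag Gamma -> pos_diag Psi ->
  (forall k, random_matrix (X k)) ->
  independent_matrices P X ->
  (forall k, multinormal P (fun w => vec (X k w)) mu (Psi *t Gamma)) ->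
  {ae P, forall w, exists S : 'M[R]_(q * p), diag_mle (fun k => X k w) S}.
Proof.
move=> p0 q0 n2 [_ Gamma_gt0] [_ Psi_gt0] rX indep normalX.
pose k0 : 'I_n := Ordinal (ltnW n2); pose k1 : 'I_n := Ordinal n2.
have entries_neq i j : {ae P, forall w, X k0 w i j != X k1 w i j}.
  pose v := (Psi *t Gamma) (mxtens_index (j, i)) (mxtens_index (j, i)).
  (* The variance is Psi_jj Gamma_ii; its positivity excludes the point-mass case of
     [normal_law]. *)
  have v0 : 0 < v by rewrite /v tensmxE mulr_gt0.
  apply: (@ae_neq_of_independent _ _ _ _ _ _ (normal_peak (Num.sqrt v))).
  - exact: measurable_random_entry.
  - exact: measurable_random_entry.
  - by move=> A mA; apply: independent_entries.
  - move=> a b ab; rewrite (multinormal_entry _ _ _ _ i j _ (normalX k0))//.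
    rewrite -/v /normal_law gt_eqF//; apply: normal_prob_itv_le => //.
    by rewrite gt_eqF// sqrtr_gt0.
have all_neq : {ae P, forall w, forall i j, X k0 w i j != X k1 w i j}.
  (* There are finitely many entries, so the exceptional null sets can be united. *)
  by apply: filter_forall => i; apply: filter_forall => j; exact: entries_neq.
apply: filterS all_neq => w neqw.
exact: (diag_mle_exists _ k0 k1).
Qed.
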